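(* Let $A\subseteq\mathbb{N}$. The following properties are equivalent: (1) There exist disjoint infinite sets $B,C\subseteq\mathbb{N}$ with $(B\oplus B)+C\subseteq A$. (2) There exist distinct non-principal ultrafilters $\mathcal{U}$ and $\mathcal{V}$ on $\mathbb{N}$ such that $$A\in(\mathcal{U}\oplus\mathcal{U}\oplus\mathcal{V})\cap(\mathcal{U}\oplus\mathcal{V}\oplus\mathcal{U})\cap(\mathcal{V}\oplus\mathcal{U}\oplus\mathcal{U}).$$
   Context: $\mathbb{N}=\{1,2,3,\ldots\}$. For infinite $B\subseteq\mathbb{N}$, $B\oplus B=\{b+b'\mid b,b'\in B,\ b\ne b'\}$, and $(B\oplus B)+C=\{b+b'+c\mid b,b'\in B,\ b\neq b',\ c\in C\}$. The pseudo-sum of ultrafilters $\mathcal{U},\mathcal{V}$ on $\mathbb{N}$ is the ultrafilter $\mathcal{U}\oplus\mathcal{V}$ on $\mathbb{N}$ defined by $A\in\mathcal{U}\oplus\mathcal{V}\iff\{n\in\mathbb{N}\mid A-n\in\mathcal{V}\}\in\mathcal{U}$, where $A-n=\{m\in\mathbb{N}\mid m+n\in A\}$. This operation is associative (but not commutative). *)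

(* Defs.v *)
(* The set N = {1, 2, 3, ...} is the type [positive] of the Rocq standard
   library, with its addition [Pos.add]. *)
From Stdlib Require Import PArith.
From mathcomp Require Import all_boot.
From mathcomp Require Import boolp classical_sets cardinality filter.

Set Implicit Arguments.
Unset Strict Implicit.
Unset Printing Implicit Defensive.

Local Open Scope classical_set_scope.

Definition sumset (X Y : set positive) : set positive :=
  [set (x + y)%positive | x in X & y in Y].

Definition distinct_sumset (B : set positive) : set positive :=
  [set n | exists b b', [/\ B b, B b', b <> b' & n = (b + b')%positive]].

Definition shift (A : set positive) (n : positive) : set positive :=
  [set m | A (m + n)%positive].

Definition pseudosum (U V : set_system positive) : set_system positive :=
  [set A | U [set n | V (shift A n)]].

Declare Scope ultra_scope.
Notation "U ⊕ V" := (pseudosum U V) (at level 50, left associativity)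
  : ultra_scope.

Definition nonprincipal (U : set_system positive) : Prop :=
  forall n, U <> principal_filter n.

Local Open Scope ultra_scope.

Lemma pseudosumA U V W : U ⊕ (V ⊕ W) = U ⊕ V ⊕ W.
Proof.
rewrite predeqE => A; rewrite /pseudosum /shift /=.
suff -> : [set n | V [set n0 | W [set m | A (m + n0 + n)%positive]]] =
  [set n | V [set m | W [set m0 | A (m0 + (m + n))%positive]]] by [].
rewrite predeqE => n /=.
suff -> : [set n0 | W [set m | A (m + n0 + n)%positive]] =
  [set m | W [set m0 | A (m0 + (m + n))%positive]] by [].
rewrite predeqE => p /=.
suff -> : [set m | A (m + p + n)%positive] =
  [set m | A (m + (p + n))%positive] by [].
by rewrite predeqE => m /=; rewrite Pos.add_assoc.
Qed.

Lemma pseudosum_ultra U V :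
  UltraFilter U -> UltraFilter V -> UltraFilter (U ⊕ V).
Proof.
move=> UU UV; split.
  split.
    move=> H; apply: (@filter_not_empty _ U).
    apply: (@filterS _ U _ _ _ _ H) => n /= Hn.
    exact: (@filter_not_empty _ V).
  split=> [|P Q HP HQ|P Q PQ HP].
  - rewrite /pseudosum /=; apply: filterE => n.
    by rewrite /=; apply: filterE.
  - apply: (@filterS _ U _ _ _ _ (@filterI _ U _ _ _ HP HQ)) => n [/= Pn Qn].
    exact: (@filterI _ V _ (shift P n) (shift Q n)).
  - apply: (@filterS _ U _ _ _ _ HP) => n /=.
    by apply: filterS => m; exact: PQ.
move=> G GP subG; apply/seteqP; split=> // A GA.
case: (in_ultra_setVsetC [set n | V (shift A n)] UU) => // HC.
exfalso; apply: (@filter_not_empty _ G).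
rewrite -(setICr A); apply: filterI => //; apply: subG.
apply: (@filterS _ U _ _ _ _ HC) => n /= nV.
by case: (in_ultra_setVsetC (shift A n) UV).
Qed.

(* Main.v *)
Require Import Defs.
From HB Require Import structures.
From Stdlib Require Import PArith.
From mathcomp Require Import all_boot.
From mathcomp Require Import boolp classical_sets cardinality filter.

(** The ultrafilters turn the ternary relation [A (b + b' + c)], symmetric in
    [b] and [b'], into statements about iterated ultrafilter quantifiers: the
    three memberships of (2) say that this relation holds for [U]-many [b],
    [U]-many [b'] and [V]-many [c], where the variable [c] is quantified last,
    second or first ([pseudosums_near]).

    From (1) to (2), any non-principal ultrafilter on [B] and any non-principal
    ultrafilter on [C] will do: a non-principal ultrafilter ignores the
    coincidence [b = b'], and the two ultrafilters differ because [B] and [C]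
    are disjoint.

    From (2) to (1), fix a set [D] in [U] but not in [V], and build the elements
    of [B] inside [D] and those of [C] outside [D], alternately and one at a
    time.  When a triple [b, b', c] is completed, its [c] may have come last,
    second or first, and this is why all three iterated sums are needed.  The
    finite stages keep the invariant [admissible]: each way of choosing at most
    three distinct elements of the stage as part of a triple can be continued
    to a full triple with the remaining quantifiers, in any order.  Since the
    next element has to meet only finitely many conditions, each true for
    [U]-many (or [V]-many) elements, a stage can always be extended
    ([admissible_consl], [admissible_consr]). *)

Local Open Scope classical_set_scope.
Local Open Scope ultra_scope.

(** * Filters and ultrafilters *)

Lemma near_forall_seq {X : Type} {T : eqType} (F : set_system X) {FF : Filter F}
    (s : seq T) (P : T -> X -> Prop) :
  (forall t, t \in s -> \forall x \near F, P t x) ->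
  \forall x \near F, forall t, t \in s -> P t x.
Proof.
elim: s => [_|a s IHs Ps]; first by apply: filterE.
have Fa := Ps a (mem_head a s).
have Fs := IHs (fun t ts => Ps t (@mem_behead _ (a :: s) t ts)).
apply: filterS2 Fa Fs => x Pa Pst t.
by rewrite inE => /predU1P[->|/Pst].
Qed.

Lemma near_notin {T : eqType} (F : set_system T) {FF : Filter F} (s : seq T) :
  (forall t, \forall x \near F, x <> t) -> \forall x \near F, x \notin s.
Proof.
move=> Fneq.
have /near_forall_seq : forall t, t \in s -> \forall x \near F, x <> t by [].
by apply: filterS => x xs; apply/negP => /xs.
Qed.

Lemma ultra_near_neq {T : Type} (U : set_system T) (t : T) :
  UltraFilter U -> U <> principal_filter t -> \forall x \near U, x <> t.
Proof.
move=> UU Ut; case: (in_ultra_setVsetC [set t] UU) => // Uset1.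
case: Ut; symmetry; apply: max_filter.
  exact: principal_filter_proper.
move=> P UP; apply/principal_filterP.
by have [x [Px <-]] := filter_ex (filterI UP Uset1).
Qed.

(** An ultrafilter is a maximal filter, so distinct ones are incomparable. *)
Lemma ultra_separate {T : Type} (U V : set_system T) :
  UltraFilter U -> UltraFilter V -> U <> V -> exists2 D, U D & V (~` D).
Proof.
move=> UU UV UneqV; apply: contrapT => noD; apply: UneqV.
symmetry; apply: max_filter => D UD.
by case: (in_ultra_setVsetC D UV) => // VD; case: noD; exists D.
Qed.

(** The sets containing all but finitely many elements of [B] form a proper
    filter, and an ultrafilter refining it cannot be principal. *)
Lemma infinite_set_ultra {T : Type} (B : set T) :
  infinite_set B ->
  exists U : set_system T,
    [/\ UltraFilter U, U B & forall t, \forall x \near U, x <> t].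
Proof.
move=> Binf; pose F := [set P : set T | finite_set (B `\` P)].
have FP : ProperFilter F.
  split; first by rewrite /F /= setD0.
  split=> [|P Q|P Q PQ]; rewrite /F /=.
  - by rewrite setDT; exact: finite_set0.
  - by move=> finP finQ; rewrite setDIr finite_setU.
  - by apply: sub_finite_set; apply: setDS.
have [U [UU FU]] := ultraFilterLemma FP; exists U; split=> // [|t].
  by apply: FU; rewrite /F /= setDv; exact: finite_set0.
apply: FU; apply: sub_finite_set (finite_set1 t).
by move=> x [_ /contrapT].
Qed.

(** * The alternating construction *)

Lemma infinite_bigcup_uniq {T : eqType} (s : nat -> seq T) :
  (forall n, uniq (s n)) -> (forall n, size (s n) = n) ->
  infinite_set (\bigcup_n [set` s n]).
Proof.
move=> us ss /finite_seqP[r sr].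
have : size (s (size r).+1) <= size r.
  apply: uniq_leq_size => // x xs.
  suff : [set` r] x by [].
  by rewrite -sr; exists (size r).+1.
by rewrite ss ltnn.
Qed.

Section AlternatingConstruction.
Context {T : eqType} {U V : set_system T}.
Context {UF : ProperFilter U} {VF : ProperFilter V}.
Hypothesis Uneq : forall t, \forall x \near U, x <> t.
Hypothesis Vneq : forall t, \forall x \near V, x <> t.
Variables (D : set T) (R : T -> T -> T -> Prop).
Hypothesis Rsym : forall b b' c, R b b' c -> R b' b c.

(** The last six fields list the proper nonempty parts of a triple, and the
    whole triple, that a stage may already contain; the elements still to be
    chosen appear as quantifiers, in each order in which they may come. *)
Record admissible (B C : seq T) : Prop := Admissible {
  adm_uniql : uniq B;
  adm_uniqr : uniq C;
  adm_subl : forall b, b \in B -> D b;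
  adm_subr : forall c, c \in C -> ~ D c;
  adm_b_bc : forall b, b \in B -> \forall b' \near U, \forall c \near V, R b b' c;
  adm_b_cb : forall b, b \in B -> \forall c \near V, \forall b' \near U, R b b' c;
  adm_c_bb : forall c, c \in C -> \forall b \near U, \forall b' \near U, R b b' c;
  adm_bb_c : forall b b', b \in B -> b' \in B -> b != b' ->
    \forall c \near V, R b b' c;
  adm_bc_b : forall b c, b \in B -> c \in C -> \forall b' \near U, R b b' c;
  adm_bbc : forall b b' c, b \in B -> b' \in B -> b != b' -> c \in C -> R b b' c
}.

Lemma admissible_nil : admissible [::] [::].
Proof. by split. Qed.

Hypothesis UD : U D.
Hypothesis VD : V (~` D).
Hypothesis near_bbc :
  \forall b \near U, \forall b' \near U, \forall c \near V, R b b' c.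
Hypothesis near_bcb :
  \forall b \near U, \forall c \near V, \forall b' \near U, R b b' c.
Hypothesis near_cbb :
  \forall c \near V, \forall b \near U, \forall b' \near U, R b b' c.

(** The finitely many conditions on the new element [x] read off the fields of
    the old stage, with [x] in the role of the variable that is quantified
    first; triples in which [x] stands in the place of [b] instead of [b']
    follow by the symmetry of [R]. *)
Lemma admissible_consl B C :
  admissible B C -> \forall b \near U, admissible (b :: B) C.
Proof.
case=> uB uC BD CD b_bc b_cb c_bb bb_c bc_b bbc.
have n_notin : \forall x \near U, x \notin B by exact: near_notin.
have n_bb_c : \forall b' \near U, forall b, b \in B ->
    \forall c \near V, R b b' c by exact: near_forall_seq.
have n_bc_b : \forall b \near U, forall c, c \in C ->
    \forall b' \near U, R b b' c by exact: near_forall_seq.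
have n_bbc : \forall b' \near U, forall b, b \in B ->
    forall c, c \in C -> R b b' c.
  apply: near_forall_seq => b bB.
  by apply: near_forall_seq => c cC; exact: bc_b.
apply: filterS (filterI (filterI n_notin UD) (filterI
  (filterI near_bbc near_bcb) (filterI n_bb_c (filterI n_bc_b n_bbc)))).
move=> x [[xB xD] [[x_bc x_cb] [xbb_c [xbc_b xbbc]]]].
split=> //.
- by rewrite /= xB.
- by move=> b; rewrite inE => /predU1P[->|/BD//].
- by move=> b; rewrite inE => /predU1P[->|/b_bc//].
- by move=> b; rewrite inE => /predU1P[->|/b_cb//].
- move=> b b'; rewrite !inE => /predU1P[->|bB] /predU1P[->|b'B] neq.
  + by rewrite eqxx in neq.
  + by apply: filterS (xbb_c _ b'B) => c; exact: Rsym.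
  + exact: xbb_c.
  + exact: bb_c.
- by move=> b c; rewrite inE => /predU1P[->|bB] cC; [exact: xbc_b|exact: bc_b].
- move=> b b' c; rewrite !inE => /predU1P[->|bB] /predU1P[->|b'B] neq cC.
  + by rewrite eqxx in neq.
  + by apply: Rsym; exact: xbbc.
  + exact: xbbc.
  + exact: bbc.
Qed.

(** Since [b] and [b'] differ in a stage, the pairs in [B] of which [x] completes
    a triple are only the off-diagonal ones. *)
Lemma admissible_consr B C :
  admissible B C -> \forall c \near V, admissible B (c :: C).
Proof.
case=> uB uC BD CD b_bc b_cb c_bb bb_c bc_b bbc.
have n_notin : \forall x \near V, x \notin C by exact: near_notin.
have n_bc_b : \forall c \near V, forall b, b \in B ->
    \forall b' \near U, R b b' c by exact: near_forall_seq.
have n_bbc : \forall c \near V, forall b, b \in B ->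
    forall b', b' \in B -> b != b' -> R b b' c.
  apply: near_forall_seq => b bB; apply: near_forall_seq => b' b'B.
  have [<-|neq] := eqVneq b b'; first by apply: filterE.
  by apply: filterS (bb_c _ _ bB b'B neq).
apply: filterS (filterI (filterI n_notin VD) (filterI
  near_cbb (filterI n_bc_b n_bbc))).
move=> x [[xC xD] [x_bb [xbc_b xbbc]]].
split=> //.
- by rewrite /= xC.
- by move=> c; rewrite inE => /predU1P[->|/CD//].
- by move=> c; rewrite inE => /predU1P[->|/c_bb//].
- by move=> b c bB; rewrite inE => /predU1P[->|cC]; [exact: xbc_b|exact: bc_b].
- move=> b b' c bB b'B neq; rewrite inE => /predU1P[->|cC].
    exact: xbbc.
  exact: bbc.
Qed.

(** Any triple from the unions of the stages already lies in a single stage,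
    because the stages increase. *)
Lemma alternating_sets :
  exists B C : set T,
    [/\ infinite_set B, infinite_set C, B `&` C = set0 &
        forall b b' c, B b -> B b' -> b <> b' -> C c -> R b b' c].
Proof.
pose stage := {s : seq T * seq T | admissible s.1 s.2}.
pose next (s s' : stage) := exists b c : T,
  sval s' = (b :: (sval s).1, c :: (sval s).2).
have next_ex s : {s' | next s s'}.
  apply: cid; case: s => -[B C] /= admBC.
  have [b admb] := filter_ex (admissible_consl _ _ admBC).
  have [c admc] := filter_ex (admissible_consr _ _ admb).
  by exists (exist _ (b :: B, c :: C) admc), b, c.
have [f [f0 fS]] := dependent_choice next_ex
  (exist _ ([::], [::]) admissible_nil).
pose B n := (sval (f n)).1; pose C n := (sval (f n)).2.
have adm n : admissible (B n) (C n) := svalP (f n).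
have sizeB n : size (B n) = n.
  elim: n => [|n IHn]; first by rewrite /B f0.
  by rewrite /B; have [b [c ->]] := fS n; rewrite /= -/(B n) IHn.
have sizeC n : size (C n) = n.
  elim: n => [|n IHn]; first by rewrite /C f0.
  by rewrite /C; have [b [c ->]] := fS n; rewrite /= -/(C n) IHn.
have subB m n : m <= n -> {subset B m <= B n}.
  elim: n => [|n IHn]; first by rewrite leqn0 => /eqP->.
  rewrite leq_eqVlt ltnS => /predU1P[->//|/IHn sub] x /sub.
  by rewrite /B; have [b [c ->]] := fS n; rewrite inE => ->; rewrite orbT.
have subC m n : m <= n -> {subset C m <= C n}.
  elim: n => [|n IHn]; first by rewrite leqn0 => /eqP->.
  rewrite leq_eqVlt ltnS => /predU1P[->//|/IHn sub] x /sub.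
  by rewrite /C; have [b [c ->]] := fS n; rewrite inE => ->; rewrite orbT.
exists (\bigcup_n [set` B n]), (\bigcup_n [set` C n]); split.
- by apply: infinite_bigcup_uniq => // n; exact: adm_uniql (adm n).
- by apply: infinite_bigcup_uniq => // n; exact: adm_uniqr (adm n).
- rewrite -subset0 => x [[m _ /= xB] [n _ /= xC]].
  exact: adm_subr (adm n) _ xC (adm_subl _ _ (adm m) _ xB).
- move=> b b' c [i _ /= bB] [j _ /= b'B] /eqP neq [k _ /= cC].
  pose n := maxn i (maxn j k).
  apply: (adm_bbc _ _ (adm n)) => //.
  + by apply: subB bB; rewrite leq_maxl.
  + by apply: subB b'B; rewrite /n maxnCA leq_maxl.
  + by apply: subC cC; rewrite /n !leq_max leqnn !orbT.
Qed.

End AlternatingConstruction.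

(** * Iterated pseudo-sums and sumsets *)

Lemma pseudosum3 (U V W : set_system positive) (A : set positive)
    (f : positive -> positive -> positive -> positive) :
  (forall x y z, z + (y + x) = f x y z)%positive ->
  (U ⊕ V ⊕ W) A =
  (\forall x \near U, \forall y \near V, \forall z \near W, A (f x y z)).
Proof.
move=> fE; congr (U _); apply/funext => x; congr (V _); apply/funext => y.
by congr (W _); apply/funext => z; rewrite /shift /= fE.
Qed.

(** Commutativity of addition brings the three iterated sums to one and the
    same ternary relation, under differently ordered quantifiers. *)
Lemma pseudosums_near (U V : set_system positive) (A : set positive) :
  ((U ⊕ U ⊕ V) `&` (U ⊕ V ⊕ U) `&` (V ⊕ U ⊕ U)) A <->
  [/\ \forall b \near U, \forall b' \near U, \forall c \near V,
        A (b + b' + c)%positive,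
      \forall b \near U, \forall c \near V, \forall b' \near U,
        A (b + b' + c)%positive &
      \forall c \near V, \forall b \near U, \forall b' \near U,
        A (b + b' + c)%positive].
Proof.
have bbcE x y z : (z + (y + x) = x + y + z)%positive.
  by rewrite Pos.add_comm (Pos.add_comm y).
have bcbE x y z : (z + (y + x) = x + z + y)%positive.
  by rewrite bbcE -!Pos.add_assoc (Pos.add_comm y).
have cbbE x y z : (z + (y + x) = y + z + x)%positive.
  by rewrite Pos.add_assoc (Pos.add_comm z).
rewrite /= (pseudosum3 _ _ _ _ _ bbcE) (pseudosum3 _ _ _ _ _ bcbE).
rewrite (pseudosum3 _ _ _ _ _ cbbE).
by split=> [[[]]|[]].
Qed.

HB.instance Definition _ := hasDecEq.Build positive Pos.eqb_spec.

Theorem proposition6p18 (A : set positive) :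
  (exists B C : set positive,
     [/\ infinite_set B, infinite_set C, B `&` C = set0 &
         sumset (distinct_sumset B) C `<=` A])
  <->
  (exists U V : set_system positive,
     [/\ UltraFilter U /\ nonprincipal U,
         UltraFilter V /\ nonprincipal V,
         U <> V &
         ((U ⊕ U ⊕ V) `&` (U ⊕ V ⊕ U) `&` (V ⊕ U ⊕ U)) A]).
Proof.
split=> [[B [C [Binf Cinf BC BBC]]]|[U [V [[UU Unp] [UV Vnp] UneqV]]]].
  have [U [UU UB Uneq]] := infinite_set_ultra B Binf.
  have [V [UV VC Vneq]] := infinite_set_ultra C Cinf.
  have np (W : set_system positive) :
      (forall t, \forall x \near W, x <> t) -> nonprincipal W.
    by move=> Wneq n Wn; have := Wneq n; rewrite Wn => /(_ n erefl).
  have bbcA b b' c : B b -> B b' -> b' <> b -> C c -> A (b + b' + c)%positive.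
    move=> Bb Bb' neq Cc; apply: BBC; exists (b + b')%positive.
      by exists b, b'; split=> // /esym.
    by exists c.
  exists U, V; split.
  - by split=> //; exact: np.
  - by split=> //; exact: np.
  - move=> UVeq; rewrite -UVeq in VC.
    by have [x] := filter_ex (filterI UB VC); rewrite BC.
  - apply/pseudosums_near; split.
    + apply: filterS (UB) => b Bb.
      apply: filterS2 UB (Uneq b) => b' Bb' neq.
      by apply: filterS VC => c Cc; exact: bbcA.
    + apply: filterS (UB) => b Bb; apply: filterS VC => c Cc.
      by apply: filterS2 UB (Uneq b) => b' Bb' neq; exact: bbcA.
    + apply: filterS VC => c Cc; apply: filterS (UB) => b Bb.
      by apply: filterS2 UB (Uneq b) => b' Bb' neq; exact: bbcA.
move=> /pseudosums_near[near_bbc near_bcb near_cbb].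
have [D UD VD] := ultra_separate U V UU UV UneqV.
have Uneq t := ultra_near_neq U t UU (Unp t).
have Vneq t := ultra_near_neq V t UV (Vnp t).
pose R b b' c := A (b + b' + c)%positive.
have Rsym b b' c : R b b' c -> R b' b c by rewrite /R (Pos.add_comm b).
have [B [C [Binf Cinf BC BBC]]] := alternating_sets Uneq Vneq D R Rsym UD VD
  near_bbc near_bcb near_cbb.
exists B, C; split=> // _ [_ [b [b' [Bb Bb' neq ->]]] [c Cc <-]].
exact: BBC.
Qed.
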